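(* Let $R_{n,k}$ be as defined in the context. For $n\ge1$ and $k\ge1$, \[R_{n,k}=(2k+1)R_{n-1,k}+(n-2k+1)R_{n-1,k-1},\] and moreover $R_{n,0}=1$ for all $n\ge0$ and $R_{0,k}=0$ for all $k\ge1$.
   Context: For $n\ge1$, $S_n$ is the set of permutations of $\{0,\dots,n-1\}$ in one-line notation. A 3-dimensional permutation of length $n$ is a pair $\Pi=(\pi^2,\pi^3)$ of elements of $S_n$ (for $n=0$, the single empty permutation); its elements are the columns $\Pi_j=(\pi^2_j,\pi^3_j)^T$, and the level of $\Pi_j$ is $\max\{\pi^2_j,\pi^3_j\}$. $\Pi$ is canonical if $\pi^2=01\cdots(n-1)$. Each level value is attained by at most two elements. $R_{n,k}$ is the number of canonical 3-dimensional permutations of length $n$ in which exactly $k$ distinct level values are each attained by two elements. *)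

(* Defs.v *)
From mathcomp Require Import all_boot all_order all_algebra all_fingroup.

Set Implicit Arguments.
Unset Strict Implicit.
Unset Printing Implicit Defensive.

(* The pair (pi^2, pi^3); 'S_0 is a singleton, so perm3 0 has exactly one
   element, the empty permutation. *)
Notation perm3 n := ('S_n * 'S_n)%type.

Definition column (n : nat) (P : perm3 n) (j : 'I_n) : 'I_n * 'I_n :=
  (P.1 j, P.2 j).

Definition elements (n : nat) (P : perm3 n) : {set 'I_n * 'I_n} :=
  [set column P j | j : 'I_n].

Definition level (n : nat) (c : 'I_n * 'I_n) : nat := maxn c.1 c.2.

Definition canonical (n : nat) (P : perm3 n) : bool :=
  [forall j : 'I_n, P.1 j == j].

Definition at_level (n : nat) (P : perm3 n) (v : nat) : {set 'I_n * 'I_n} :=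
  [set c in elements P | level c == v].

(* Every level is smaller than n, so v : 'I_n covers all level values. *)
Definition double_levels (n : nat) (P : perm3 n) : {set 'I_n} :=
  [set v : 'I_n | #|at_level P v| == 2].

Definition R (n k : nat) : nat :=
  #|[set P : perm3 n | canonical P & #|double_levels P| == k]|.

(* Main.v *)
Require Import Defs.
From mathcomp Require Import all_boot all_order all_algebra all_fingroup.
From mathcomp Require Import zify.

(** In a canonical permutation (id, p) the level v is attained twice exactly
    when v is a cycle peak of p, that is, p^-1(v) < v > p(v).  Every permutation
    of n+1 elements arises uniquely from a permutation s of n elements, either by
    adding the new maximum as a fixed point, or by inserting it in one of the n
    arcs i -> s(i).  The first choice preserves the number of peaks; the second
    creates a peak at the maximum and destroys the peak, if any, at an end of the
    arc.  Cycle peaks are never adjacent, so k peaks meet exactly 2k arcs. *)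

Set Implicit Arguments.
Unset Strict Implicit.
Unset Printing Implicit Defensive.

Import GRing.Theory.

Definition peaks n (p : 'S_n) : {set 'I_n} :=
  [set v | (p v < v) && (p^-1%g v < v)].

Lemma mem_peaks n (p : 'S_n) (v : 'I_n) :
  (v \in peaks p) = (p v < v) && (p^-1%g v < v).
Proof. by rewrite inE. Qed.

Lemma perm_neq_inv n (p : 'S_n) (v : 'I_n) : (v == p^-1%g v) = (p v == v).
Proof. by rewrite -(inj_eq (@perm_inj _ p) v) permKV. Qed.

(** The column at position [j] is [(j, p j)], so level [v] forces [j = v] or [j = p^-1 v]. Both
    positions count and are distinct exactly when both neighbours of [v] in its cycle lie strictly
    below it. *)
Lemma card_at_level n (P : perm3 n) (v : 'I_n) :
  canonical P -> (#|at_level P v| == 2) = (v \in peaks P.2).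
Proof.
case: P => p1 p /forallP /= P1.
have {P1} -> : p1 = 1%g by apply/permP => j; rewrite perm1; apply/eqP.
pose f (j : 'I_n) := (j, p j).
have f_inj : injective f by move=> i j [].
have -> : at_level (1%g, p) v = f @: [set j : 'I_n | maxn j (p j) == v].
  apply/setP => c; apply/setIdP/imsetP => [[/imsetP[j _ ->]]|[j]].
    rewrite /column /= perm1 /level /= => jv.
    by exists j; rewrite ?inE.
  rewrite inE => jv ->; split=> //.
  by apply/imsetP; exists j; rewrite // /column /= perm1.
rewrite card_imset // mem_peaks; set A := [set j | _].
have sA : A \subset [set v; p^-1%g v].
  apply/subsetP => j; rewrite !inE.
  case: (leqP j (p j)) => _ /eqP/val_inj <-.
    by rewrite permK eqxx orbT.
  by rewrite eqxx.
have c2 := cards2 v (p^-1%g v).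
apply/eqP/andP => [A2|[pv iv]].
  have vp : v != p^-1%g v.
    by apply/eqP => e; move: (subset_leq_card sA); rewrite c2 -e eqxx A2.
  have eA : A = [set v; p^-1%g v] by apply/eqP; rewrite eqEcard sA c2 A2 vp.
  have := set21 v (p^-1%g v); have := set22 v (p^-1%g v).
  rewrite -eA !inE permKV => /eqP i2 /eqP i1.
  have: val (p v) != v by rewrite (inj_eq val_inj) -perm_neq_inv.
  have: val (p^-1%g v) != v by rewrite (inj_eq val_inj) eq_sym.
  by rewrite /=; lia.
have -> : A = [set v; p^-1%g v].
  apply/eqP; rewrite eqEsubset sA; apply/subsetP => j.
  by rewrite !inE => /orP[] /eqP ->; rewrite ?permKV; apply/eqP; lia.
by rewrite c2; case: eqP => // e; rewrite -e ltnn in iv.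
Qed.

Lemma R_peaks n k : R n k = #|[set p : 'S_n | #|peaks p| == k]|.
Proof.
pose f (p : 'S_n) : perm3 n := (1%g, p).
have f_inj : injective f by move=> p q [].
have canf p : canonical (f p) by apply/forallP => j; rewrite perm1.
have dlE P : canonical P -> double_levels P = peaks P.2.
  by move=> cP; apply/setP => v; rewrite inE card_at_level.
rewrite -(card_imset _ f_inj); apply: eq_card => P; rewrite inE.
apply/andP/imsetP => [[cP kP]|[p]]; last first.
  by rewrite inE => kp ->; rewrite dlE.
exists P.2; first by rewrite inE -dlE.
case: P {kP} cP => p1 p /forallP /= P1; congr pair.
by apply/permP => j; rewrite perm1; apply/eqP.
Qed.

(* The maximum goes to j, and the element formerly sent to j (if any) goes to
   the maximum; for j = ord_max the maximum is a fixed point. *)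
Definition insert_max n (sj : 'S_n * 'I_n.+1) : 'S_n.+1 :=
  (lift_perm ord_max ord_max sj.1 * tperm ord_max sj.2)%g.

(** The image of [ord_max] recovers the index, and cancelling the transposition recovers [s].
    Surjectivity follows by counting: n! (n+1) = (n+1)!. *)
Lemma insert_max_bij n : bijective (@insert_max n).
Proof.
apply: inj_card_bij => [[s i] [t j] /= e|].
  have ij : i = j.
    by move/permP/(_ ord_max): e; rewrite !permM /= !lift_perm_id !tpermL.
  move: e; rewrite -ij /insert_max /= => /mulIg/permP e; congr pair.
  apply/permP => x; apply: (@lift_inj _ ord_max).
  by have := e (lift ord_max x); rewrite !lift_perm_lift.
by rewrite card_prod card_ord !card_Sn factS mulnC.
Qed.

Section InsertMax.

Variables (n : nat) (s : 'S_n).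

Local Notation up := (lift (@ord_max n)).

Lemma up_neq_max a : (up a == ord_max) = false.
Proof. by apply/negbTE; rewrite eq_sym neq_lift. Qed.

Lemma val_up a : up a = a :> nat.
Proof. exact: lift_max. Qed.

Lemma peaks_insert_fixed : peaks (insert_max (s, ord_max)) = up @: peaks s.
Proof.
rewrite /insert_max /= tperm1 mulg1; apply/setP => x.
case: (unliftP ord_max x) => [a|] ->.
  rewrite (mem_imset _ _ lift_inj) !mem_peaks lift_permV !lift_perm_lift.
  by rewrite !val_up.
rewrite mem_peaks lift_perm_id ltnn; apply/esym/imsetP => -[a _ /eqP].
by rewrite eq_sym up_neq_max.
Qed.

Lemma max_ltF (x : 'I_n.+1) : (@ord_max n < x) = false.
Proof. by rewrite ltnNge -ltnS ltn_ord. Qed.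

Lemma tperm_up (a b : 'I_n) :
  tperm ord_max (up a) (up b) = if b == a then ord_max else up b.
Proof. by rewrite permE /= up_neq_max (inj_eq lift_inj). Qed.

(** The maximum splits the arc from [s^-1 a] to [a]. Both ends gain a larger neighbour, and all
    other elements keep theirs. *)
Lemma peaks_insert_arc (a : 'I_n) :
  peaks (insert_max (s, up a)) =
  ord_max |: up @: (peaks s :\: [set a; s^-1%g a]).
Proof.
apply/setP => x; rewrite mem_peaks /insert_max /= invMg tpermV lift_permV !permM.
case: (unliftP ord_max x) => [b|] ->; last first.
  by rewrite lift_perm_id !tpermL lift_perm_lift !val_up !inE eqxx !ltn_ord.
rewrite in_setU1 up_neq_max (mem_imset _ _ lift_inj) in_setD in_set2 mem_peaks.
rewrite lift_perm_lift !tperm_up.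
(* Restates [b == s^-1 a] as [s b == a], the test made by the transposition. *)
rewrite -(inj_eq (@perm_inj _ s) b (s^-1%g a)) permKV.
case: (b =P a) => [_|ba].
  by rewrite lift_perm_id max_ltF andbF.
rewrite lift_perm_lift; case: (s b =P a) => [_|_].
  by rewrite max_ltF.
by rewrite !val_up.
Qed.

(** An arc is named by its target: [peaks s] gives the arcs entering a peak, and the image gives
    those leaving one. *)
Definition arcs_at_peaks : {set 'I_n} := peaks s :|: s @: peaks s.

Lemma peak_image_notin a : a \in peaks s -> s a \notin peaks s.
Proof.
rewrite !mem_peaks permK => /andP[sa _].
by apply/negP => /andP[_]; rewrite ltnNge ltnW.
Qed.

Lemma disjoint_peaks_image : peaks s :&: s @: peaks s = set0.
Proof.
apply/setP => x; rewrite !inE -mem_peaks; apply/negP => /andP[xp /imsetP[a ap e]].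
by move: (peak_image_notin ap); rewrite -e xp.
Qed.

Lemma card_arcs_at_peaks : #|arcs_at_peaks| = #|peaks s|.*2.
Proof.
rewrite cardsU disjoint_peaks_image cards0 subn0 card_imset ?addnn //.
exact: perm_inj.
Qed.

(** At most one end of the arc is a peak, so the new peak at the maximum either replaces it or is a
    net gain. *)
Lemma card_peaks_insert_arc a :
  #|peaks (insert_max (s, up a))| = #|peaks s| + (a \notin arcs_at_peaks).
Proof.
rewrite peaks_insert_arc cardsU1 (card_imset _ lift_inj).
have -> : ord_max \notin up @: (peaks s :\: [set a; s^-1%g a]).
  by apply/imsetP => -[b _ /eqP]; rewrite eq_sym up_neq_max.
have -> : (a \in arcs_at_peaks) = (a \in peaks s) || (s^-1%g a \in peaks s).
  by rewrite inE -{2}(permKV s a) (mem_imset _ _ (@perm_inj _ s)).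
have /implyP := peak_image_notin (a := s^-1%g a); rewrite permKV.
rewrite setUC -setDDl.
have := cardsD1 a (peaks s :\ s^-1%g a); have := cardsD1 (s^-1%g a) (peaks s).
rewrite in_setD1 perm_neq_inv.
(* On a loop the two removed ends coincide, but a fixed point is never a peak. *)
have: (a \in peaks s) ==> (s a != a).
  apply/implyP; rewrite mem_peaks => /andP[+ _].
  by apply: contraTneq => ->; rewrite ltnn.
case: (a \in peaks s); case: (s^-1%g a \in peaks s); case: (s a == a);
  by move=> //= _ -> -> _; rewrite ?add0n ?addn0 ?addn1 ?add1n.
Qed.

(** If [s] has m peaks, the fixed point and the 2m arcs at peaks keep that number, and the other n -
    2m arcs raise it by one. *)
Lemma sum_insert_max k :
  \sum_(j < n.+1) (#|peaks (insert_max (s, j))| == k) =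
  (#|peaks s| == k) * k.*2.+1 + (#|peaks s|.+1 == k) * (n - (k.-1).*2).
Proof.
rewrite (bigD1_ord ord_max) //= peaks_insert_fixed (card_imset _ lift_inj).
under eq_bigr do rewrite card_peaks_insert_arc.
rewrite (bigID (mem arcs_at_peaks)) /=.
under eq_bigr => a aA do rewrite aA addn0.
under [X in _ + (_ + X)]eq_bigr => a aA do rewrite aA addn1.
rewrite !sum_nat_const card_arcs_at_peaks.
have -> : #|[pred a | a \notin arcs_at_peaks]| = n - #|peaks s|.*2.
  have := cardC (mem arcs_at_peaks); rewrite card_ord card_arcs_at_peaks.
  by move/(congr1 (subn^~ #|peaks s|.*2)); rewrite addKn.
case: (#|peaks s| =P k) => [->|_]; first by rewrite gtn_eqF // ?muln1 !muln0 !mul1n; lia.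
by case: (_.+1 =P k) => [<-|_] /=; rewrite ?muln0 ?muln1 ?mul1n.
Qed.

End InsertMax.

Lemma R_sum n k : R n k = \sum_(p : 'S_n) (#|peaks p| == k).
Proof. by rewrite R_peaks cardsE -sum1_card big_mkcond. Qed.

Lemma double_peaks_le n (s : 'S_n) : #|peaks s|.*2 <= n.
Proof. by rewrite -card_arcs_at_peaks -[leqRHS]card_ord max_card. Qed.

Lemma R_double_gt n k : n < k.*2 -> R n k = 0.
Proof.
move=> nk; rewrite R_sum big1 // => s _.
by case: eqP (double_peaks_le s) => // ->; rewrite leqNgt nk.
Qed.

Lemma R_succ n k :
  R n.+1 k = k.*2.+1 * R n k + (0 < k) * ((n - (k.-1).*2) * R n k.-1).
Proof.
rewrite R_sum (reindex _ (onW_bij _ (@insert_max_bij n))) /=.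
rewrite -(pair_bigA _ (fun s j => nat_of_bool (#|peaks (insert_max (s, j))| == k))) /=.
under eq_bigr do rewrite sum_insert_max.
rewrite big_split /= -!big_distrl /= -R_sum mulnC; congr (_ + _).
(* At [k = 0] the second sum vanishes, since no successor equals 0; the factor [0 < k] records
   this. *)
case: k => [|k] /=; first by rewrite big1.
by rewrite mul1n mulnC -R_sum.
Qed.

Lemma R_0 k : R 0 k = (k == 0).
Proof.
case: k => [|k]; last by rewrite R_double_gt.
rewrite R_sum (eq_bigr (fun=> 1)) ?sum1_card ?card_Sn // => s _.
by have := double_peaks_le s; rewrite leqn0 double_eq0 => ->.
Qed.

Local Open Scope ring_scope.

(* The recurrence is stated in int because n - 2k + 1 may be negative. *)
Theorem theorem3p1 :
  (forall n k : nat, (1 <= n)%N -> (1 <= k)%N ->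
     (R n k)%:Z = (2 * k%:Z + 1) * (R (n - 1) k)%:Z
                  + (n%:Z - 2 * k%:Z + 1) * (R (n - 1) (k - 1))%:Z)
  /\ (forall n : nat, R n 0 = 1%N)
  /\ (forall k : nat, (1 <= k)%N -> R 0 k = 0%N).
Proof.
split=> [[//|n] [//|k] _ _|]; last first.
  split=> [n|[|k] // _]; last by rewrite R_0.
  by elim: n => [|n IHn]; rewrite ?R_0 // R_succ IHn.
rewrite R_succ !subn1 /= mul1n.
(* After the shift of both indices the integer factor is n - 2k. Where it is negative, truncated
   subtraction differs from it, but both multiply [R n k = 0]. *)
have [nk|kn] := ltnP n k.*2; last by nia.
by rewrite (R_double_gt nk); nia.
Qed.
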